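(* Let $\vec S$ be a universe of set separations of a set $V$ with the order function $|X,Y|_r=r(X)+r(Y)-r(V)$ for some non-negative non-decreasing submodular function $r:2^V\to\mathbb N$, let $k\in\mathbb N$, and let $\mathcal F$ be a family of stars, each a finite multiset of elements of $\vec S_k$, which is fixed under shifting. If there exists an $S_k$-tree over $\mathcal F$, then there exists an $\mathcal F$-lean $S_k$-tree over $\mathcal F$.
   Context: For a set $V$, $\mathrm{sep}(V)=\{(A,B):A\cup B=V\}$, ordered by $(A,B)\le(C,D)$ iff $A\subseteq C$ and $B\supseteq D$, with involution $(A,B)^*=(B,A)$. A set separation system is a subset of $\mathrm{sep}(V)$ closed under $*$; a universe of set separations is one closed also under $(A,B)\wedge(C,D)=(A\cap C,B\cup D)$ and $(A,B)\vee(C,D)=(A\cup C,B\cap D)$. Let $\vec S_k=\{(A,B)\in\vec S:|A,B|_r<k\}$. For $(A,B)\le(C,D)$ put $\lambda((A,B),(C,D))=\min\{|X,Y|_r:(X,Y)\in\vec S,(A,B)\le(X,Y)\le(C,D)\}$; $(X,Y)$ is linked to $(A,B)$ if $(A,B)\le(X,Y)$ and $|X,Y|_r=\lambda((A,B),(X,Y))$. A star is a finite multiset $\sigma$ of separations such that any two of its members (distinct as members of the multiset) $(A,B),(C,D)$ satisfy $(A,B)\le(D,C)$. For a set separation system $\vec R$, an $R$-tree is a pair $(T,\alpha)$ with $T$ a finite tree and $\alpha$ a map from the set $\vec E(T)$ of oriented edges $(x,y)$ of $T$ to $\vec R$ with $\alpha(y,x)=\alpha(x,y)^*$; an $S_k$-tree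 is an $R$-tree for $\vec R=\vec S_k$. For $t\in V(T)$ let $\vec F_t=\{(x,t)\in\vec E(T)\}$ and $\sigma_t=\alpha(\vec F_t)$ (as a multiset); $(T,\alpha)$ is tame if every $\sigma_t$ is a star, and over $\mathcal F$ if every $\sigma_t\in\mathcal F$. Oriented edges are ordered by $(x,y)\le(u,v)$ iff they are equal or $T$ contains a path whose vertex sequence begins $x,y$ and ends $u,v$ (with $y=u$ allowed). For $\vec e=(x,y)$, $T(\vec e)$ is the subtree consisting of the component of $T-x$ containing $y$ together with $x$ and the edge $xy$. Shift: given a tame $R$-tree $(T,\alpha)$, $\vec e\in\vec E(T)$ and a separation $(X,Y)\ge\alpha(\vec e)$, the shift of $(T,\alpha)$ onto $(X,Y)$ with respect to $\vec e$ is $(T(\vec e),\alpha')$ where for each edge $f$ of $T(\vec e)$, with $\vec f$ its orientation satisfying $\vec e\le\vec f$ and $\overleftarrow f$ the reverse, $\alpha'(\vec f)=\alpha(\vec f)\vee(X,Y)$ and $\alpha'(\overleftarrow f)=\alpha(\overleftarrow f)\wedge(Y,X)$. A family $\mathcal F$ of finite multisets of elements of $\vec R$ is fixed under shifting if whenever $\sigma\in\mathcal F$, $(T,\alpha)$ is a tame $R$-tree, $\vec e=(t,t')\in\vec E(T)$, $\sigma=\alpha(\vec F_s)$ for some $s\in V(T(\vec e))\setminus\{t\}$, and $(X,Y)\in\vec R$ is linked to $\alpha(\vec e)$, then in the shift $(T(\vec e),\alpha')$ onto $(X,Y)$ with respect to $\vec e$ we have $\alpha'(\vec F_s)\in\mathcal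 F$. For an $S_k$-tree $(T,\alpha)$ over $\mathcal F$, a separation $(A,B)$ is addable at $t\in V(T)$ if $\sigma_t\cup\{(A,B)\}\in\mathcal F$. Such a tree is $\mathcal F$-lean if for every pair of vertices $t,t'$ and every pair of separations $(A,B)\le(B',A')$ with $(A,B)$ addable at $t$ and $(A',B')$ addable at $t'$, either $\lambda((A,B),(B',A'))\ge\min\{r(A),r(A')\}$ or $\min\{|\alpha(\vec g)|_r:\vec g$ an edge of the path $tTt'$ oriented towards $t'\}=\lambda((A,B),(B',A'))$ (the minimum over the empty set, when $t=t'$, being $+\infty$). *)

(* Defs.v *)
From HB Require Import structures.
From mathcomp Require Import all_boot finmap multiset.
From mathcomp Require Import boolp classical_sets.

Set Implicit Arguments.
Unset Strict Implicit.
Unset Printing Implicit Defensive.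

Local Open Scope classical_set_scope.

Section Separations.
Context {V : Type}.

(* Pairs of subsets of V; that such a pair (A, B) covers V is the separate
   predicate [is_sep]. *)
Definition sep : Type := (set V * set V)%type.
HB.instance Definition _ := Choice.on sep.

Implicit Types (a b c x : sep) (S R : set sep).

Definition is_sep a : Prop := a.1 `|` a.2 = setT.
Definition sep_le a b : Prop := a.1 `<=` b.1 /\ b.2 `<=` a.2.
Definition sep_inv a : sep := (a.2, a.1).
Definition sep_meet a b : sep := (a.1 `&` b.1, a.2 `|` b.2).
Definition sep_join a b : sep := (a.1 `|` b.1, a.2 `&` b.2).

Definition is_sep_system S : Prop :=
  (forall a, S a -> is_sep a) /\ (forall a, S a -> S (sep_inv a)).

Definition is_universe S : Prop :=
  [/\ is_sep_system S,
      forall a b, S a -> S b -> S (sep_meet a b) &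
      forall a b, S a -> S b -> S (sep_join a b)].

Definition nondecreasing_setfun (r : set V -> nat) : Prop :=
  forall A B : set V, A `<=` B -> r A <= r B.

Definition submodular (r : set V -> nat) : Prop :=
  forall A B : set V, r (A `|` B) + r (A `&` B) <= r A + r B.

(* The subtraction is the truncated one of nat, but for r submodular and
   nondecreasing and a covering V, r setT <= r a.1 + r a.2, so that no
   truncation takes place. *)
Definition sep_order (r : set V -> nat) a : nat := r a.1 + r a.2 - r setT.

Definition sep_lt_order S (r : set V -> nat) (k : nat) : set sep :=
  [set a | S a /\ sep_order r a < k].

(* The empty set has no minimum; this renders the convention that its minimum
   is +oo when the minimum is compared for equality with a natural number. *)
Definition is_min (P : set nat) (n : nat) : Prop :=
  P n /\ forall m, P m -> n <= m.

(* The value 0 is a dummy, taken only if S has no element between a and c. *)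
Definition lambda S (r : set V -> nat) a c : nat :=
  xget 0 (is_min [set n | exists x,
    [/\ S x, sep_le a x, sep_le x c & n = sep_order r x]]).

Definition linked S (r : set V -> nat) x a : Prop :=
  sep_le a x /\ sep_order r x = lambda S r a x.

(* Removing one copy of a before choosing b makes a and b distinct as members
   of the multiset, while allowing a = b if the multiplicity is at least 2. *)
Definition is_star (s : {mset sep}%mset) : Prop :=
  forall a b, a \in s -> b \in (s `\ a)%mset -> sep_le a (sep_inv b).

End Separations.

Arguments sep : clear implicits.

Section Graphs.
Context {T : finType}.
Variable e : rel T.

Definition acyclic : Prop := forall c : seq T, 2 < size c -> ~ ucycle e c.

Definition is_tree : Prop :=
  [/\ symmetric e, irreflexive e, 0 < #|T|, (forall x y, connect e x y)
    & acyclic].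

(* (x, y) <= (u, v); the one-edge path p = [:: x; y] gives the case of
   equality. *)
Definition oedge_le (x y u v : T) : Prop :=
  exists p : seq T,
    [/\ sorted e p, uniq p, prefix [:: x; y] p & suffix [:: u; v] p].

Definition on_path_between (t t' u v : T) : Prop :=
  exists p : seq T,
    [/\ path e t p, uniq (t :: p), last t p = t' & infix [:: u; v] (t :: p)].

Definition in_comp_minus (x y : T) : pred T :=
  connect [rel u v | [&& e u v, u != x & v != x]] y.

Definition branch_vert (x y : T) : pred T :=
  [pred v | (v == x) || in_comp_minus x y v].

Definition branch_edge (x y : T) : rel T :=
  [rel u v | [|| [&& in_comp_minus x y u, in_comp_minus x y v & e u v],
                 (u == x) && (v == y) | (u == y) && (v == x)]].

End Graphs.

(* A finite graph with a separation attached to each ordered pair of vertices;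
   the values of [lab] at pairs that are not edges are irrelevant. *)
Record sep_graph (V : Type) := SepGraph {
  vert :> finType;
  edge : rel vert;
  lab : vert -> vert -> sep V
}.

Section SepTrees.
Context {V : Type}.
Implicit Types (R S : set (sep V)) (r : set V -> nat) (T : sep_graph V).
Implicit Types (F : set {mset sep V}%mset).

Definition is_sep_tree R T : Prop :=
  is_tree (@edge V T) /\
  forall x y : T, edge x y -> R (lab x y) /\ lab y x = sep_inv (lab x y).

Definition sigma T (t : T) : {mset sep V}%mset :=
  seq_mset [seq lab x t | x <- enum T & edge x t].

Definition tame T : Prop := forall t : T, is_star (sigma t).

Definition tree_over F T : Prop := forall t : T, F (sigma t).

Definition shift_lab T (x y : T) (c : sep V) (u v : T) : sep V :=
  if `[< oedge_le (@edge V T) x y u v >] then sep_join (lab u v) c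
  else sep_meet (lab u v) (sep_inv c).

(* The shift of T onto c with respect to the oriented edge (x, y). *)
Definition shift T (x y : T) (c : sep V) : sep_graph V :=
  @SepGraph V {v : T | branch_vert (@edge V T) x y v}
    (fun u v => branch_edge (@edge V T) x y (val u) (val v))
    (fun u v => shift_lab x y c (val u) (val v)).

Definition fixed_under_shifting S r R F : Prop :=
  forall T (t t' : T) (c : sep V) (s : shift t t' c),
    is_sep_tree R T -> tame T -> edge t t' ->
    R c -> linked S r c (lab t t') ->
    val s != t -> F (sigma (val s)) -> F (sigma s).

Definition addable F T (a : sep V) (t : T) : Prop := F (a +` sigma t)%mset.

Definition lean S r F T : Prop :=
  forall (t t' : T) (a a' : sep V),
    addable F a t -> addable F a' t' -> sep_le a (sep_inv a') ->
    minn (r a.1) (r a'.1) <= lambda S r a (sep_inv a')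
    \/ is_min [set n | exists u v : T, on_path_between (@edge V T) t t' u v /\
                         n = sep_order r (lab u v)]
              (lambda S r a (sep_inv a')).

End SepTrees.

(* Main.v *)
Require Import Defs.
From mathcomp Require Import all_boot finmap multiset.
From mathcomp Require Import boolp classical_sets.
From mathcomp Require Import zify.

(** Write N = r(V) and give a vertex s the weight w(s) = N - sum (N - r(B)),
    summed over the members (A, B) of sigma_s; for graphs this is the size of
    the bag at s. Among all S_k-trees over F take one for which the numbers of
    vertices of weight >= q plus oriented edges with both ends of weight >= q
    are lexicographically minimal, for q running from N down to 0.

    Suppose that it is not F-lean, witnessed by (A, B) addable at t and (A',
    B') addable at t'. Among the separations of least order between (A, B) and
    (B', A') choose x = (X, Y) crossing as few edge separations as possible.
    Take one copy of T shifted onto (Y, X) from a leaf (A', B') added at t',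
    another copy shifted onto (X, Y) from a leaf (A, B) added at t, and
    identify the two leaf edges; the result is again over F. By submodularity
    no copy of a vertex is heavier than the vertex, the copy of t in the second
    tree is lighter than t, and likewise for t' in the first. If a copy of s
    keeps the weight w(s) > |x|, then a corner of x and an edge at s has order
    |x|, so that by the choice of x they are nested, which forces the other
    copy of s to weight <= |x|. Hence above |x| the counts do not increase
    until some vertex loses weight in both copies; if there is no such vertex,
    the path from t to t' contains an edge whose ends keep their weights in
    different copies, and the count for q = |x| + 1 decreases. *)

Set Implicit Arguments.
Unset Strict Implicit.
Unset Printing Implicit Defensive.

Local Open Scope classical_set_scope.

(** * Minimal choices and counting *)

Lemma ex_argmin (X : Type) (P : X -> Prop) (f : X -> nat) :
  (exists x, P x) -> exists x, P x /\ forall y, P y -> f x <= f y.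
Proof.
move=> [x0 Px0]; have exn : exists n, `[< exists2 x, P x & f x = n >].
  by exists (f x0); apply/asboolP; exists x0.
have [n /asboolP[x Px <-] min] := ex_minnP exn.
by exists x; split=> // y Py; apply: min; apply/asboolP; exists y.
Qed.

Lemma ex_lexmin (X : Type) (P : X -> Prop) (f : nat -> X -> nat) n :
  (exists x, P x) -> exists x, P x /\ forall y, P y -> forall i, i < n ->
    (forall j, j < i -> f j y <= f j x) -> f i x <= f i y.
Proof.
move=> exP; elim: n => [|n [x0 [Px0 min0]]].
  by case: exP => x Px; exists x.
pose Q y := P y /\ forall j, j < n -> f j y <= f j x0.
have [|x [[Px Qx] minx]] := @ex_argmin X Q (f n); first by exists x0.
exists x; split=> // y Py i; rewrite ltnS leq_eqVlt => /predU1P[->|ltin] fyx.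
  by apply: minx; split=> // j jn; apply: leq_trans (fyx j jn) (Qx j jn).
apply: leq_trans (Qx i ltin) _; apply: min0 => // j ji.
by apply: leq_trans (fyx j ji) (Qx j _); lia.
Qed.

Lemma leq_card_in_inj (X Y : finType) (A : pred X) (B : pred Y) (f : X -> Y) :
  {in A &, injective f} -> (forall x, A x -> B (f x)) -> #|A| <= #|B|.
Proof.
move=> injf fB; rewrite -(card_in_image injf); apply: subset_leq_card.
by apply/fintype.subsetP => y /fintype.imageP[x Ax ->]; apply: fB.
Qed.

Lemma ltn_card_in_inj (X Y : finType) (A : pred X) (B : pred Y) (f : X -> Y) y :
  {in A &, injective f} -> (forall x, A x -> B (f x)) ->
  B y -> (forall x, A x -> f x != y) -> #|A| < #|B|.
Proof.
move=> injf fB By ny; rewrite (cardD1 y B) [y \in B]By ltnS.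
by apply: leq_card_in_inj injf _ => x Ax; rewrite !inE ny //; apply: fB.
Qed.

Lemma path_exit (T : eqType) (P : pred T) t p : P t -> ~~ P (last t p) ->
  exists u v, [/\ infix [:: u; v] (t :: p), P u & ~~ P v].
Proof.
elim: p t => [|v p IH] t Pt nP; first by rewrite /= Pt in nP.
have [Pv|nPv] := boolP (P v); last first.
  by exists t, v; rewrite (prefixW (prefix_prefix _ p)).
have [u [w [uw Pu Pw]]] := IH v Pv nP.
by exists u, w; split=> //; apply: infix_trans uw (infix_cons _ _).
Qed.

(** * Non-backtracking walks in trees *)

Section Walks.
Variables (T : finType) (e : rel T).

(* In a tree non-backtracking walks are paths, so that this is the order of the
   oriented edges; but unlike paths they concatenate without side conditions. *)
Inductive walk (x y : T) : T -> T -> Prop :=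
| walk1 : e x y -> walk x y x y
| walkS u v w : walk x y u v -> e v w -> w <> u -> walk x y v w.

Definition away (t u v : T) : Prop := exists y, walk t y u v.

Definition simple_path (p : seq T) : bool := sorted e p && uniq p.

Lemma walk_last_edge x y u v : walk x y u v -> e u v.
Proof. by case. Qed.

Lemma walk_first_edge x y u v : walk x y u v -> e x y.
Proof. by elim. Qed.

Lemma walk_trans x y u v w z : walk x y u v -> walk u v w z -> walk x y w z.
Proof. by move=> xu; elim=> [//|a b c _ IH bc ca]; apply: walkS IH bc ca. Qed.

Lemma walk_source x y u v : walk x y u v -> u = x \/ exists z, walk x y z u.
Proof. by case=> [|u' v' w uv' _ _]; [left | right; exists u']. Qed.

Lemma away_edge t u v : away t u v -> e u v.
Proof. by case=> y /walk_last_edge. Qed.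

Lemma away1 t v : e t v -> away t t v.
Proof. by move=> tv; exists v; apply: walk1. Qed.

Lemma awayS t u v w : away t u v -> e v w -> w <> u -> away t v w.
Proof. by move=> [y yuv] vw wu; exists y; apply: walkS yuv vw wu. Qed.

Lemma simple_path_prefix p q : prefix p q -> simple_path q -> simple_path p.
Proof.
case/prefixP=> s -> /andP[so un]; apply/andP; split; last first.
  by move: un; rewrite cat_uniq => /and3P[].
by have [] := cat_sorted2 so.
Qed.

Lemma simple_path_walk x y p u v :
  simple_path [:: x, y & p] -> suffix [:: u; v] [:: x, y & p] -> walk x y u v.
Proof.
move=> /andP[so un] /suffixP[s].
elim: p x y s so un => [|z p IH] x y s /=.
  rewrite andbT => xy _; case: s => [|a [|b [|c s]]] // [<- <-].
  exact: walk1.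
case: s => [//|a s] /and3P[xy yz pz] /andP[xp un] [_ E].
have zx : z <> x by move=> zx; move: xp; rewrite zx !inE eqxx orbT.
apply: walk_trans (walkS (walk1 xy) yz zx) _.
by apply: (IH y z s); rewrite /= ?yz.
Qed.

Lemma oedge_le_walk x y u v : oedge_le e x y u v -> walk x y u v.
Proof.
case=> p [so un /prefixP[s E]]; rewrite {}E in so un * => uv.
by apply: (@simple_path_walk x y s) => //; apply/andP.
Qed.

Lemma simple_path_away t p u v :
  simple_path (t :: p) -> suffix [:: u; v] (t :: p) -> away t u v.
Proof.
case: p => [_ /size_suffix //|y p] sp uv.
by exists y; apply: simple_path_walk sp uv.
Qed.

Lemma acyclic_walk : (forall x y u, ~ walk x y u x) -> acyclic e.
Proof.
move=> closed [|x [|y c]] //; case/lastP: c => [//|c v] _ /andP[cy un].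
have E : [:: x, y & rcons c v] = (x :: belast y c) ++ [:: last y c; v].
  by rewrite -(cat_rcons (last y c)) /= -lastI cats1.
move: cy; rewrite /= !rcons_path last_rcons -rcons_path => /and3P[xy yc vx].
have W : walk x y (last y c) v.
  apply: (@simple_path_walk x y (rcons c v)); last by rewrite E suffix_suffix.
  by apply/andP; split=> //=; rewrite xy.
apply: closed (walkS W vx _) => lx; move: un.
by rewrite lx /= -rcons_cons mem_rcons inE mem_last orbT.
Qed.

Lemma on_path_between_sym t t' u v : symmetric e ->
  on_path_between e t t' u v -> on_path_between e t' t v u.
Proof.
move=> sym [p [pp un <- uv]]; exists (rev (belast t p)).
have E : rev (t :: p) = last t p :: rev (belast t p) by rewrite lastI rev_rcons.
split; rewrite -?E ?rev_uniq ?(infix_rev [:: u; v]) //.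
  by rewrite rev_path (eq_path (e' := e)) // => x y; rewrite sym.
by case: p {pp un uv E} => //= y p; rewrite rev_cons last_rcons.
Qed.

Hypothesis e_tree : is_tree e.

Let e_sym : symmetric e. Proof. by case: e_tree. Qed.
Let e_irr : irreflexive e. Proof. by case: e_tree. Qed.
Let e_conn x y : connect e x y. Proof. by case: e_tree. Qed.
Let e_acyc : acyclic e. Proof. by case: e_tree. Qed.

Lemma walk_rev x y u v : walk x y u v -> walk v u y x.
Proof.
elim=> [xy|u' v' w W IH vw wu]; first by apply: walk1; rewrite e_sym.
apply: walk_trans IH; apply: walkS (nesym wu); last first.
  by rewrite e_sym; apply: walk_last_edge W.
by apply: walk1; rewrite e_sym.
Qed.

Lemma simple_path_rcons p u v w : simple_path p -> suffix [:: u; v] p ->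
  e v w -> w <> u -> simple_path (rcons p w).
Proof.
move=> /andP[so un] /suffixP[s E] vw wu; subst p.
have sow : sorted e (rcons (s ++ [:: u; v]) w).
  rewrite -cats1 -catA; case: s so {un} => [|a s] /=.
    by rewrite vw !andbT.
  by rewrite !cat_path /= vw !andbT.
apply/andP; split=> //; rewrite rcons_uniq un andbT; apply/negP.
have wv : w != v by apply: contraTneq vw => ->; rewrite e_irr.
rewrite mem_cat !inE (negPf wv) (introF eqP wu) !orbF => ws.
case/splitPr: ws so un sow => p1 p2 _.
rewrite -catA cat_uniq rcons_cat => /and3P[_ _ un] /cat_sorted2[_ so].
apply: (e_acyc (c := w :: p2 ++ [:: u; v])); last exact/andP.
by rewrite /= size_cat addn2.
Qed.

Lemma walk_extend p u v w z :
  simple_path p -> suffix [:: u; v] p -> walk u v w z ->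
  exists q, simple_path (p ++ q) /\ suffix [:: w; z] (p ++ q).
Proof.
move=> sp uvp; elim=> [_|a b c _ [q [sq abq]] bc ca].
  by exists [::]; rewrite cats0.
exists (rcons q c); rewrite -rcons_cat.
split; first exact: simple_path_rcons sq abq bc ca.
by rewrite (suffix_rcons [:: b]) eqxx (catl_suffix (s := [:: a]) abq).
Qed.

Lemma walk_oedge_le x y u v : walk x y u v -> oedge_le e x y u v.
Proof.
move=> W; have xy := walk_first_edge W.
have sp : simple_path [:: x; y].
  rewrite /simple_path /= xy mem_seq1 /= andbT.
  by apply: contraTneq xy => ->; rewrite e_irr.
have [q [/andP[so un] uvq]] := walk_extend sp (suffix_refl _) W.
by exists ([:: x; y] ++ q); rewrite prefix_prefix.
Qed.

Lemma walk_open x y u : ~ walk x y u x.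
Proof.
case/walk_oedge_le=> p [_ un /prefixP[s E] /suffixP[s' E']].
rewrite {}E' in E un; case: s' E un => [|a s'] /= [-> _].
  by rewrite !inE eqxx.
by rewrite mem_cat !inE eqxx !orbT.
Qed.

Lemma away_root t u : ~ away t u t.
Proof. by case=> y /walk_open. Qed.

Lemma away_asym t u v : away t u v -> ~ away t v u.
Proof.
by move=> [y W] [y' /walk_rev W']; apply: walk_open (walk_trans W W').
Qed.

Lemma away_parent_uniq t u u' v : away t u v -> away t u' v -> u = u'.
Proof.
move=> [y W] [y' W']; apply: contrapT => uu'.
have vu' : e v u' by rewrite e_sym; apply: walk_last_edge W'.
exact: walk_open (walk_trans (walkS W vu' (nesym uu')) (walk_rev W')).
Qed.

Lemma away_exists t v : v = t \/ exists u, away t u v.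
Proof.
have /connectP[p pp ->] := e_conn t v.
elim/last_ind: p pp => [|p w IH]; first by left.
rewrite rcons_path last_rcons => /andP[/IH[->|[u tu]] vw].
  by right; exists t; apply: away1.
have [->|wu] := pselect (w = u).
  case: tu => y /walk_source[->|[z W]]; first by left.
  by right; exists z; exists y.
by right; exists (last t p); apply: awayS tu vw wu.
Qed.

Lemma away_total t u v : e u v -> away t u v \/ away t v u.
Proof.
have [->|[z tu]] := away_exists t u => uv; first by left; apply: away1.
have [->|vz] := pselect (v = z); first by right.
by left; apply: awayS tu uv vz.
Qed.

Lemma on_path_betweenP t t' u v :
  on_path_between e t t' u v <-> away t u v /\ away t' v u.
Proof.
have path_away s s' a b : on_path_between e s s' a b -> away s a b.
  move=> [p [pp un _ /infixP[s1 [s2 E]]]].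
  have pre : prefix (s1 ++ [:: a; b]) (s :: p) by rewrite E catA prefix_prefix.
  have ab : suffix [:: a; b] (s1 ++ [:: a; b]) by rewrite suffix_suffix.
  have := simple_path_prefix pre; rewrite {1}/simple_path /= pp => /(_ un).
  case: (s1 ++ _) pre ab => [_ /size_suffix //|c p' /=].
  by case: eqP => // -> _ ab; move/simple_path_away; apply.
split=> [uv|[[y W] [y' /walk_rev W']]].
  split; first exact: path_away uv.
  exact: path_away (on_path_between_sym e_sym uv).
have [p [so un /prefixP[s Ep]]] := walk_oedge_le W; rewrite {}Ep in so un *.
move=> uvp; have [|q [/andP[so' un'] /suffixP[s' E]]] := walk_extend _ uvp W'.
  exact/andP.
exists (y :: s ++ q); split=> //.
  by rewrite -[last t _]/(last t ([:: t, y & s] ++ q)) E last_cat.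
by rewrite -[t :: _]/([:: t, y & s] ++ q); apply/infix_catr/suffixW.
Qed.

End Walks.

(** * Gluing two trees along a new edge *)

Section Glue.
Variables (T1 T2 : finType) (e1 : rel T1) (e2 : rel T2) (v1 : T1) (v2 : T2).

Definition glue_rel : rel (T1 + T2)%type :=
  fun p q => match p, q with
  | inl u, inl v => e1 u v
  | inr u, inr v => e2 u v
  | inl u, inr v => (u == v1) && (v == v2)
  | inr u, inl v => (v == v1) && (u == v2)
  end.

Lemma glue_walk_inl x y p q : is_tree e2 ->
  walk glue_rel (inl x) y p q ->
  [\/ exists u v, [/\ p = inl u, q = inl v & away e1 x u v],
      p = inl v1 /\ q = inr v2 |
      exists u v, [/\ p = inr u, q = inr v & away e2 v2 u v]].
Proof.
move=> tr2; elim=> [|a b c _ IH bc ca].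
  case: y => y /=; last by case/andP=> /eqP-> /eqP->; constructor 2.
  by move=> xy; constructor 1; exists x, y; split=> //; apply: away1.
case: IH c ca bc => [[u [v [-> -> A]]]|[-> ->]|[u [v [-> -> A]]]] [w|w] wu //=.
- move=> vw; constructor 1; exists v, w; split=> //.
  by apply: awayS A vw _ => E; apply: wu; rewrite E.
- by case/andP=> /eqP-> /eqP->; constructor 2.
- by case/andP=> /eqP E; case: wu; rewrite E.
- by move=> vw; constructor 3; exists v2, w; split=> //; apply: away1.
- by case/andP=> _ /eqP E; rewrite E in A; case: (away_root tr2 A).
- move=> vw; constructor 3; exists v, w; split=> //.
  by apply: awayS A vw _ => E; apply: wu; rewrite E.
Qed.

Lemma glue_walk_inl_open x y u : is_tree e1 -> is_tree e2 ->
  ~ walk glue_rel (inl x) y u (inl x).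
Proof.
move=> tr1 tr2 /(glue_walk_inl tr2)[[a [b [_ [<-] A]]]|[//]|[a [b [//]]]].
exact: (away_root tr1 A).
Qed.

End Glue.

Definition sum_swap (A B : Type) (p : A + B) : B + A :=
  match p with inl a => inr a | inr b => inl b end.

Lemma sum_swap_inj A B : injective (@sum_swap A B).
Proof. by move=> [a|b] [a'|b'] //= [->]. Qed.

Lemma glue_rel_swap (T1 T2 : finType) (e1 : rel T1) (e2 : rel T2) v1 v2 p q :
  glue_rel e2 e1 v2 v1 (sum_swap p) (sum_swap q) = glue_rel e1 e2 v1 v2 p q.
Proof. by case: p q => [u|u] [v|v] //=; rewrite andbC. Qed.

Lemma walk_homo (T T' : finType) (e : rel T) (e' : rel T') (f : T -> T') :
  injective f -> {homo f : u v / e u v >-> e' u v} ->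
  forall x y u v, walk e x y u v -> walk e' (f x) (f y) (f u) (f v).
Proof.
move=> injf ef x y u v; elim=> [xy|a b c _ IH bc ca]; first exact/walk1/ef.
by apply: walkS IH (ef _ _ bc) _ => /injf.
Qed.

Lemma connect_homo (T T' : finType) (e : rel T) (e' : rel T') (f : T -> T') :
  {homo f : u v / e u v >-> e' u v} ->
  {homo f : u v / connect e u v >-> connect e' u v}.
Proof.
move=> ef u _ /connectP[p pp ->]; apply/connectP; exists (map f p).
  exact: homo_path pp.
by rewrite last_map.
Qed.

Lemma glue_tree (T1 T2 : finType) (e1 : rel T1) (e2 : rel T2) v1 v2 :
  is_tree e1 -> is_tree e2 -> is_tree (glue_rel e1 e2 v1 v2).
Proof.
move=> tr1 tr2; have [sym1 irr1 n1 conn1 _] := tr1.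
have [sym2 irr2 _ conn2 _] := tr2; set e := glue_rel _ _ _ _.
have e_sym : symmetric e by case=> [u|u] [v|v] //=.
split=> //; [by case | by rewrite card_sum addn_gt0 n1 | |].
- have conn_inl u : connect e (inl v1) (inl u).
    exact: connect_homo (conn1 v1 u).
  have conn_inr u : connect e (inl v1) (inr u).
    apply: (@connect_trans _ _ (inr v2)); last exact: connect_homo (conn2 v2 u).
    by apply: connect1; rewrite /= !eqxx.
  have conn_v1 p : connect e (inl v1) p by case: p.
  by move=> p q; apply: connect_trans (conn_v1 q); rewrite sym_connect_sym.
- apply: acyclic_walk => -[x|x] y u W.
    exact: (glue_walk_inl_open tr1 tr2 W).
  apply: (@glue_walk_inl_open _ _ _ _ v2 v1 x (sum_swap y) _ tr2 tr1).
  apply: (walk_homo (@sum_swap_inj _ _) _ W) => p q.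
  by rewrite glue_rel_swap.
Qed.

Definition no_edge : rel unit := fun _ _ => false.

Lemma no_edge_tree : is_tree no_edge.
Proof.
split=> //; first by rewrite card_unit.
- by move=> [] []; apply: connect0.
- by move=> [|[] [|[] c]] // _ /andP[].
Qed.

Definition leaf_rel (T : finType) (e : rel T) (t : T) : rel (unit + T)%type :=
  glue_rel no_edge e tt t.

Section Leaf.
Variables (T : finType) (e : rel T) (t : T).
Hypothesis e_tree : is_tree e.

Lemma leaf_rel_tree : is_tree (leaf_rel e t).
Proof. exact: glue_tree no_edge_tree e_tree. Qed.

Lemma leaf_walkE u v :
  walk (leaf_rel e t) (inl tt) (inr t) (inr u) (inr v) <-> away e t u v.
Proof.
split=> [/(glue_walk_inl e_tree)|[y]].
  by move=> [[u' [v' []]]|[]|[u' [v' [[->] [->]]]]].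
elim=> [ty|a b c _ IH bc ca]; last by apply: (walkS IH) => // -[].
by apply: (@walkS _ _ _ _ (inl tt)) => //; apply: walk1; rewrite /= !eqxx.
Qed.

Lemma leaf_branch_vert p : branch_vert (leaf_rel e t) (inl tt) (inr t) p.
Proof.
case: p => [[]|s] //.
have [_ _ _ conn _] := e_tree; rewrite /branch_vert /= /in_comp_minus.
by apply: (@connect_homo _ _ e _ inr) (conn t s) => u v /= ->.
Qed.

Lemma leaf_branch_edge :
  branch_edge (leaf_rel e t) (inl tt) (inr t) =2 leaf_rel e t.
Proof.
have comp_inr s : in_comp_minus (leaf_rel e t) (inl tt) (inr t) (inr s).
  by have := leaf_branch_vert (inr s); rewrite /branch_vert.
have comp_inl : ~~ in_comp_minus (leaf_rel e t) (inl tt) (inr t) (inl tt).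
  apply/negP => /connectP[p]; case/lastP: p => // p q.
  by rewrite rcons_path last_rcons => /andP[_ +] E; rewrite -E /= !andbF.
by rewrite /branch_edge => -[[]|u] [[]|v] /=;
  rewrite ?comp_inr ?(negPf comp_inl) ?andbF ?orbF ?andbT.
Qed.

End Leaf.

(** * Separations *)

Section Separations.
Context {V : Type}.
Implicit Types (a b c f g x y : sep V) (S : set (sep V)).

Lemma sep_invK a : sep_inv (sep_inv a) = a. Proof. by case: a. Qed.

Lemma sep_le_refl a : sep_le a a. Proof. by split. Qed.

Lemma sep_le_trans b a c : sep_le a b -> sep_le b c -> sep_le a c.
Proof. by move=> [ab ba] [bc cb]; split=> v; [move/ab/bc | move/cb/ba]. Qed.

Lemma sep_le_inv a b : sep_le a b -> sep_le (sep_inv b) (sep_inv a).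
Proof. by case. Qed.

Lemma sep_le_invC a b : sep_le a (sep_inv b) -> sep_le b (sep_inv a).
Proof. by case. Qed.

Lemma sep_le_meet a b c : sep_le a b -> sep_le a c -> sep_le a (sep_meet b c).
Proof.
move=> [ab ba] [ac ca]; split=> v /=; last by case=> [/ba|/ca].
by move=> av; split; [apply: ab | apply: ac].
Qed.

Lemma sep_meet_lel a b : sep_le (sep_meet a b) a.
Proof. by split=> v /=; [case | left]. Qed.

Lemma sep_meet_ler a b : sep_le (sep_meet a b) b.
Proof. by split=> v /=; [case | right]. Qed.

Lemma sep_meet_l a b : sep_le a b -> sep_meet a b = a.
Proof.
by case: a b => [A B] [C D] [/= AC DB]; rewrite /sep_meet /= setIidl // setUidl.
Qed.

Lemma sep_join_r a b : sep_le a b -> sep_join a b = b.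
Proof.
by case: a b => [A B] [C D] [/= AC DB]; rewrite /sep_join /= setUidr // setIidr.
Qed.

Lemma sep_inv_meet a b :
  sep_inv (sep_meet a b) = sep_join (sep_inv a) (sep_inv b).
Proof. by []. Qed.

Definition nested a b : Prop :=
  [\/ sep_le a b, sep_le a (sep_inv b), sep_le b a | sep_le (sep_inv b) a].

Lemma nested_invl a b : nested (sep_inv a) b <-> nested a b.
Proof.
have inv_nested c : nested c b -> nested (sep_inv c) b.
  by case=> [/sep_le_inv|/sep_le_invC|/sep_le_inv|/sep_le_inv];
    rewrite ?sep_invK => cb;
    [constructor 4 | constructor 3 | constructor 2 | constructor 1].
by split=> /inv_nested; rewrite ?sep_invK.
Qed.

Lemma nested_meet f x g : ~ nested x f -> nested x g -> nested f g ->
  nested (sep_meet f x) g.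
Proof.
move=> nxf xg fg.
have mf := sep_meet_lel f x; have mx := sep_meet_ler f x.
case: xg => [xg|xg|gx|gx].
- by constructor 1; apply: sep_le_trans mx xg.
- by constructor 2; apply: sep_le_trans mx xg.
- case: fg => [fg|fg|gf|gf].
  + by constructor 1; apply: sep_le_trans mf fg.
  + by constructor 2; apply: sep_le_trans mf fg.
  + by constructor 3; apply: sep_le_meet.
  + case: nxf; constructor 4; apply: sep_le_trans gx.
    by rewrite -(sep_invK g); apply: sep_le_inv.
- case: fg => [fg|fg|gf|gf].
  + by constructor 1; apply: sep_le_trans mf fg.
  + by constructor 2; apply: sep_le_trans mf fg.
  + case: nxf; constructor 4; apply: sep_le_trans gx; exact: sep_le_inv.
  + by constructor 4; apply: sep_le_meet.
Qed.

Lemma universe_sep S a : is_universe S -> S a -> is_sep a.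
Proof. by case=> -[sepS _] _ _; apply: sepS. Qed.

Lemma universe_inv S a : is_universe S -> S a -> S (sep_inv a).
Proof. by case=> -[_ invS] _ _; apply: invS. Qed.

Lemma universe_meet S a b : is_universe S -> S a -> S b -> S (sep_meet a b).
Proof. by case=> _ meetS _; apply: meetS. Qed.

Variable r : set V -> nat.

Lemma sep_order_inv a : sep_order r (sep_inv a) = sep_order r a.
Proof. by rewrite /sep_order /= addnC. Qed.

Definition between S a c : set (sep V) :=
  [set x | [/\ S x, sep_le a x & sep_le x c]].

Definition min_between S a c x : Prop :=
  between S a c x /\
  forall y, between S a c y -> sep_order r x <= sep_order r y.

Lemma between_inv S a c x : is_universe S ->
  between S a c x -> between S (sep_inv c) (sep_inv a) (sep_inv x).
Proof.
by move=> univ [Sx ax xc]; split; [apply: universe_inv | apply: sep_le_inv..].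
Qed.

Lemma min_between_inv S a c x : is_universe S ->
  min_between S a c x -> min_between S (sep_inv c) (sep_inv a) (sep_inv x).
Proof.
move=> univ [Bx minx]; split=> [|y /(between_inv univ)].
  exact: between_inv.
by rewrite !sep_invK sep_order_inv -(sep_order_inv y); apply: minx.
Qed.

Lemma min_between_exists S a c :
  S a -> sep_le a c -> exists x, min_between S a c x.
Proof.
by move=> Sa ac; apply: ex_argmin; exists a; split=> //; apply: sep_le_refl.
Qed.

Lemma min_between_target S a c x : min_between S a c x -> min_between S a x x.
Proof.
move=> [[Sx ax xc] minx]; split=> [|y [Sy ay yx]].
  by split=> //; apply: sep_le_refl.
by apply: minx; split=> //; apply: sep_le_trans xc.
Qed.

Lemma lambda_eq S a c x : min_between S a c x -> lambda S r a c = sep_order r x.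
Proof.
move=> [[Sx ax xc] minx]; rewrite /lambda; set M := is_min _.
have Mx : M (sep_order r x).
  by split=> [|_ [y [Sy ay yc ->]]]; [exists x | apply: minx].
have [[y [Sy ay yc E]] min] := xgetPex 0 (ex_intro M _ Mx).
by apply/eqP; rewrite eqn_leq min /= ?E ?minx //; case: Mx.
Qed.

Lemma min_between_linked S a x : min_between S a x x -> linked S r x a.
Proof. by move=> minx; split; [case: minx => -[] | apply/esym/lambda_eq]. Qed.

End Separations.

(** * Submodularity *)

Section Submodular.
Context {V : Type} (r : set V -> nat).
Hypotheses (r_mono : nondecreasing_setfun r) (r_sub : submodular r).

Definition corank (A : set V) : nat := r setT - r A.

Lemma rank_corank A : r A + corank A = r setT.
Proof. by rewrite subnKC //; apply: r_mono. Qed.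

Lemma sep_orderE a : is_sep a -> r a.1 + r a.2 = sep_order r a + r setT.
Proof. by move=> sa; have := r_sub a.1 a.2; rewrite sa /sep_order; lia. Qed.

Lemma rank_separator a A : is_sep a -> A `<=` a.1 -> A `<=` a.2 ->
  r A <= sep_order r a.
Proof.
move=> sa A1 A2; have := r_sub a.1 a.2; rewrite sa /sep_order.
have : r A <= r (a.1 `&` a.2).
  by apply: r_mono => v Av; split; [apply: A1 | apply: A2].
lia.
Qed.

Lemma sum_corank_setU_seq
    (J : eqType) (l : seq J) (B : J -> set V) (X : set V) :
  uniq l -> {in l &, forall i j, i != j -> B i `|` B j = setT} ->
  \sum_(i <- l) corank (B i) + r (X `&` \bigcap_(i in [set` l]) B i) <=
  \sum_(i <- l) corank (B i `|` X) + r X.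
Proof.
elim: l => [|i l IH] /=.
  by rewrite !big_nil => _ _; apply: r_mono => v [].
move=> /andP[il ul] cover; rewrite !big_cons.
have {}IH := IH ul (sub_in2 (fun j jl => mem_behead (s := i :: l) jl) cover).
set Z := X `&` _ in IH; set Z' := X `&` _.
have meetE : Z' = Z `&` (X `&` B i).
  apply/seteqP; split=> v /= [Xv BZ]; last first.
    case: Xv BZ => Xv Bl [_ Bi]; split=> // j /=.
    by rewrite inE => /predU1P[->//|/Bl].
  split; split=> //; last by apply: BZ; rewrite /= mem_head.
  by move=> j jl; apply: BZ; rewrite /= inE jl orbT.
have joinE : Z `|` (X `&` B i) = X.
  apply/seteqP; split=> v /=; first by case=> [[]|[]].
  move=> Xv; have [Bv|nB] := pselect (B i v); first by right.
  left; split=> // j /= jl.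
  have ij : i != j by apply: contraNneq il => ->.
  have := cover i j (mem_head _ _) (mem_behead (s := i :: l) jl) ij.
  by move/seteqP=> [_ /(_ v I)[]].
have := r_sub Z (X `&` B i); rewrite -meetE joinE.
have := r_sub (B i) X; rewrite [B i `&` X]setIC.
have := rank_corank (B i); have := rank_corank (B i `|` X).
lia.
Qed.

(* The members of a star have pairwise covering second components, and each
   first component lies in the second components of all other members. *)
Lemma sum_corank_setU
    (J : finType) (P : pred J) (B : J -> set V) (X U : set V) :
  (forall i j, P i -> P j -> i != j -> B i `|` B j = setT) ->
  U `<=` X -> (forall i, P i -> U `<=` B i) ->
  \sum_(i | P i) corank (B i) + r U <= \sum_(i | P i) corank (B i `|` X) + r X.
Proof.
move=> cover UX UB; rewrite -big_filter -[Y in _ <= Y + _]big_filter.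
set l := [seq i <- _ | _].
have lP i : i \in l -> P i by rewrite mem_filter => /andP[].
have := @sum_corank_setU_seq _ l B X (filter_uniq _ (index_enum_uniq J)).
move/(_ (fun i j il jl => cover i j (lP i il) (lP j jl))); apply: leq_trans.
rewrite leq_add2l; apply: r_mono => v Uv.
by split; [apply: UX | move=> i /lP Pi; apply: UB].
Qed.

Lemma sum_corank_le (J : finType) (P : pred J) (B : J -> set V) (U : set V) :
  (forall i j, P i -> P j -> i != j -> B i `|` B j = setT) ->
  (forall i, P i -> U `<=` B i) -> \sum_(i | P i) corank (B i) + r U <= r setT.
Proof.
move=> cover UB; apply: leq_trans (sum_corank_setU cover (@subsetT _ U) UB) _.
by rewrite big1 // => i _; rewrite setUT /corank subnn.
Qed.

End Submodular.

(** * Stars of glued and shifted trees *)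

Section Sigma.
Context {V : Type}.
Implicit Types (T G H : sep_graph V).

Lemma in_seq_mset (K : choiceType) (l : seq K) a :
  (a \in seq_mset l) = (a \in l).
Proof. exact: perm_mem (perm_eq_seq_mset l) a. Qed.

Lemma mem_sigma T (x t : T) : edge x t -> lab x t \in sigma t.
Proof.
move=> xt; rewrite in_seq_mset; apply: (map_f (fun z => lab z t)).
by rewrite mem_filter xt mem_enum.
Qed.

Lemma is_star_sigma T (t : T) :
  is_star (sigma t) <->
  (forall x y : T, edge x t -> edge y t -> x <> y ->
     sep_le (lab x t) (sep_inv (lab y t))).
Proof.
set l := [seq x <- enum T | edge x t].
have ul : uniq l by rewrite filter_uniq ?enum_uniq.
have ml x : (x \in l) = edge x t by rewrite mem_filter mem_enum andbT.
have sigma_rem x : edge x t ->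
    (sigma t `\ lab x t)%mset = seq_mset [seq lab z t | z <- rem x l].
  rewrite -ml => /perm_to_rem /(perm_map (fun z => lab z t)) /eq_seq_msetP.
  by rewrite /= mset_cons /sigma -/l => ->; rewrite msetDKB.
split=> [star x y xt yt xy|starE a b].
  apply: star; first exact: mem_sigma.
  rewrite sigma_rem // in_seq_mset; apply: (map_f (fun z => lab z t)).
  by rewrite mem_rem_uniq // inE /= ml yt andbT; apply/eqP => /esym.
rewrite in_seq_mset => /mapP[x]; rewrite -/l ml => xt ->.
rewrite sigma_rem // in_seq_mset => /mapP[y]; rewrite mem_rem_uniq // inE /= ml.
by case/andP=> /eqP yx yt ->; apply: starE => // /esym.
Qed.

Lemma sigma_iso G H (f : G -> H) (s : G) :
  injective f ->
  (forall x, edge (f x) (f s) = edge x s) ->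
  (forall y, edge y (f s) -> exists x, y = f x) ->
  (forall x, edge x s -> lab (f x) (f s) = lab x s) ->
  sigma (f s) = sigma s.
Proof.
move=> injf ef surj labf; apply/eq_seq_msetP.
have -> : [seq lab x s | x <- enum G & edge x s] =
    [seq lab y (f s) | y <- [seq f x | x <- enum G & edge x s]].
  rewrite -map_comp; apply/eq_in_map => x; rewrite mem_filter => /andP[xs _].
  by rewrite /= labf.
apply: perm_map; apply: uniq_perm.
- by rewrite filter_uniq ?enum_uniq.
- by rewrite map_inj_uniq // filter_uniq ?enum_uniq.
move=> y; rewrite mem_filter mem_enum andbT; apply/idP/mapP.
  move=> ys; have [x E] := surj y ys; exists x => //.
  by rewrite mem_filter mem_enum andbT -ef -E.
by move=> [x]; rewrite mem_filter => /andP[xs _] ->; rewrite ef.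
Qed.

Definition glue G H (v : G) (w : H) (c : sep V) : sep_graph V :=
  @SepGraph V (G + H)%type (glue_rel (@edge V G) (@edge V H) v w)
    (fun p q => match p, q with
     | inl x, inl y => lab x y
     | inr x, inr y => lab x y
     | inl _, inr _ => c
     | inr _, inl _ => sep_inv c
     end).

Definition point : sep_graph V := SepGraph no_edge (fun _ _ => (set0, set0)).

Definition add_leaf T (t : T) (a : sep V) : sep_graph V := @glue point T tt t a.

Lemma sigma_leaf_root T (t : T) a :
  sigma (inr t : add_leaf t a) = (a +` sigma t)%mset.
Proof.
rewrite -mset_cons; apply/eq_seq_msetP.
pose lab_t (p : add_leaf t a) := lab p (inr t : add_leaf t a).
have -> : a :: [seq lab x t | x <- enum T & edge x t] =
    map lab_t ((inl tt : add_leaf t a) :: [seq inr x | x <- enum T & edge x t]).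
  by rewrite /= -map_comp.
have inr_inj : injective (@inr unit T) by move=> ? ? [].
apply: perm_map; apply: uniq_perm.
- by rewrite filter_uniq ?enum_uniq.
- rewrite cons_uniq; apply/andP; split; first by apply/mapP => -[].
  by rewrite map_inj_uniq // filter_uniq ?enum_uniq.
move=> p; rewrite mem_filter mem_enum andbT inE.
by case: p => [[]|x] /=; rewrite ?eqxx // mem_map // mem_filter mem_enum andbT.
Qed.

Lemma sigma_leaf_other T (t : T) a s : s <> t ->
  sigma (inr s : add_leaf t a) = sigma s.
Proof.
move=> st; apply: (@sigma_iso T (add_leaf t a) inr) => //.
  by move=> ? ? [].
by case=> [[] /= /eqP|x _]; [| exists x].
Qed.

Lemma sigma_glue_inr G H (v : G) (w : H) c (s : H) :
  sigma (inr s : glue v w c) = sigma (inr s : add_leaf w c).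
Proof.
pose f (p : add_leaf w c) : glue v w c :=
  match p with inl _ => inl v | inr x => inr x end.
apply: (@sigma_iso (add_leaf w c) (glue v w c) f (inr s)) => //.
- by move=> [[]|x] [[]|y] //= [->].
- by case=> [[]|x] //=; rewrite !eqxx.
- by case=> [x /= /andP[/eqP-> _]|x _]; [exists (inl tt) | exists (inr x)].
- by case=> [[]|x].
Qed.

Lemma sigma_glue_inl G H (v : G) (w : H) c (s : G) :
  sigma (inl s : glue v w c) = sigma (inr s : add_leaf v (sep_inv c)).
Proof.
pose f (p : add_leaf v (sep_inv c)) : glue v w c :=
  match p with inl _ => inr w | inr x => inl x end.
apply: (@sigma_iso (add_leaf v (sep_inv c)) (glue v w c) f (inr s)) => //.
- by move=> [[]|x] [[]|y] //= [->].
- by case=> [[]|x] //=; rewrite !eqxx ?andbT.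
- by case=> [x _|x /= /andP[_ /eqP->]]; [exists (inr x) | exists (inl tt)].
- by case=> [[]|x].
Qed.

Definition root_shift T (t : T) (x : sep V) : sep_graph V :=
  @SepGraph V T (@edge V T)
    (fun u v => if `[< away (@edge V T) t u v >] then sep_join (lab u v) x
                else sep_meet (lab u v) (sep_inv x)).

Definition leaf_shift T (t : T) (x : sep V) : sep_graph V :=
  @add_leaf (root_shift t x) t x.

Lemma sigma_shift_leaf T (t : T) a x (s : T)
    (p : shift (inl tt : add_leaf t a) (inr t) x) :
  is_tree (@edge V T) -> sep_le a x -> val p = inr s ->
  sigma p = sigma (inr s : leaf_shift t x).
Proof.
move=> tr ax ps; have tr_leaf := leaf_rel_tree t tr.
pose f (q : shift (inl tt : add_leaf t a) (inr t) x) : leaf_shift t x := val q.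
have -> : (inr s : leaf_shift t x) = f p by rewrite /f ps.
symmetry; apply: sigma_iso.
- exact: val_inj.
- by move=> q; rewrite /= [branch_edge _ _ _ _ _](leaf_branch_edge t tr).
- by move=> q _; exists (exist _ q (leaf_branch_vert t tr q)).
move=> [q q_branch]; rewrite /= [branch_edge _ _ _ _ _](leaf_branch_edge t tr).
rewrite ps /f ps /= /shift_lab.
case: q {q_branch} => [[] /eqP->|u us] /=.
  rewrite asboolT ?sep_join_r //; apply: (walk_oedge_le tr_leaf).
  by apply: walk1; rewrite /= !eqxx.
congr (if _ then _ else _); apply/asboolP/asboolP => W.
  by apply: (walk_oedge_le tr_leaf); apply/(leaf_walkE t tr).
by apply/(leaf_walkE t tr)/oedge_le_walk.
Qed.

End Sigma.

(** * Tame trees *)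

Section TameTree.
Context {V : Type} (S : set (sep V)) (T : sep_graph V).
Hypotheses (T_tree : is_sep_tree S T) (T_tame : tame T).
Implicit Types (s t u v : T) (a x : sep V).

Definition fits t a : Prop := forall v, edge t v -> sep_le a (lab t v).

(* Every undirected edge that crosses x is counted twice. *)
Definition crossings x : nat :=
  #|[pred p : T * T | edge p.1 p.2 & ~~ `[< nested x (lab p.1 p.2) >]]|.

Lemma sep_tree_is_tree : is_tree (@edge V T). Proof. by case: T_tree. Qed.

Lemma edge_sym : symmetric (@edge V T). Proof. by case: sep_tree_is_tree. Qed.

Lemma lab_in u v : edge u v -> S (lab u v).
Proof. by case: T_tree => _ labT /labT[]. Qed.

Lemma lab_inv u v : edge u v -> lab v u = sep_inv (lab u v).
Proof. by case: T_tree => _ labT /labT[]. Qed.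

Lemma lab_star s u v : edge u s -> edge v s -> u <> v ->
  sep_le (lab u s) (sep_inv (lab v s)).
Proof. exact: (is_star_sigma s).1. Qed.

Lemma lab_walk s t u v : walk (@edge V T) s t u v -> sep_le (lab s t) (lab u v).
Proof.
elim=> [_|a b c W IH bc ca]; first exact: sep_le_refl.
have cb : edge c b by rewrite edge_sym.
apply: sep_le_trans IH _; rewrite (lab_inv cb).
exact: lab_star (walk_last_edge W) cb (nesym ca).
Qed.

Lemma fits_away t a u v :
  fits t a -> away (@edge V T) t u v -> sep_le a (lab u v).
Proof.
move=> ta [y W]; apply: sep_le_trans (lab_walk W).
exact: ta (walk_first_edge W).
Qed.

Lemma lab_away_edge u v (u' v' : T) : edge u v -> away (@edge V T) u u' v' ->
  sep_le (lab u v) (lab u' v') \/ sep_le (sep_inv (lab u v)) (lab u' v').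
Proof.
move=> uv [y W]; have [E|ne] := pselect (y = v).
  by left; rewrite -E; apply: lab_walk.
right; rewrite -lab_inv //; apply: lab_walk; apply: walk_trans (W).
by apply: walkS (walk_first_edge W) ne; apply: walk1; rewrite edge_sym.
Qed.

Lemma lab_nested u v (u' v' : T) : edge u v -> edge u' v' ->
  nested (lab u v) (lab u' v').
Proof.
move=> uv uv'; have [A|A] := away_total sep_tree_is_tree u uv';
  have := lab_away_edge uv A; rewrite ?(lab_inv uv').
  case=> [uu'|/sep_le_inv]; first by constructor 1.
  by rewrite sep_invK; constructor 4.
case=> [uu'|/sep_le_inv]; first by constructor 2.
by rewrite !sep_invK; constructor 3.
Qed.

Lemma crossings_inv x : crossings (sep_inv x) = crossings x.
Proof.
apply: eq_card => p; rewrite !inE; congr (_ && ~~ _).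
by apply/asboolP/asboolP => /nested_invl.
Qed.

(* An edge that does not cross x does not cross the corner of x and uv either,
   and uv itself is nested with that corner. *)
Lemma crossings_meet_lt x u v : edge u v -> ~ nested x (lab u v) ->
  crossings (sep_meet (lab u v) x) < crossings x.
Proof.
move=> uv x_uv; apply/proper_card/properP; split; last first.
  exists (u, v); rewrite !inE /= uv /=; first exact/asboolPn.
  by rewrite negbK; apply/asboolP; constructor 1; apply: sep_meet_lel.
apply/fintype.subsetP => -[u' v'].
rewrite !inE /= => /andP[uv' /asboolPn cross].
rewrite uv' /=; apply/asboolPn => x_uv'; apply: cross.
exact: nested_meet x_uv' (lab_nested uv uv').
Qed.

Lemma root_shift_inv t x u v : edge u v ->
  @lab V (root_shift t x) v u = sep_inv (@lab V (root_shift t x) u v).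
Proof.
move=> uv /=; rewrite (lab_inv uv); have tr := sep_tree_is_tree.
by have [A|A] := away_total tr t uv;
  rewrite (asboolT A) (asboolF (away_asym tr A)) // sep_inv_meet sep_invK.
Qed.

End TameTree.

(** * Weights *)

Section WeightDefs.
Context {V : Type} (r : set V -> nat).

Definition defect (T : sep_graph V) (s : T) : nat :=
  \sum_(a <- sigma s) corank r a.2.

Definition weight (T : sep_graph V) (s : T) : nat := r setT - defect s.

Lemma defectE (T : sep_graph V) (s : T) :
  defect s = \sum_(u : T | edge u s) corank r (lab u s).2.
Proof.
rewrite /defect (perm_big _ (perm_eq_seq_mset _)) big_map big_filter.
by rewrite [LHS]big_enum_cond.
Qed.

Lemma defect_add_leaf (T : sep_graph V) (t : T) a (s : T) :
  defect (inr s : add_leaf t a) = defect s + (s == t) * corank r a.2.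
Proof.
rewrite !defectE big_sumType /= addnC; congr (_ + _).
have [_|_] := eqVneq s t; last by rewrite big_pred0.
by rewrite mul1n (big_pred1 tt) // => -[].
Qed.

End WeightDefs.

(** * Heavy vertices and edges *)

Section Heavy.
Context {V : Type} (r : set V -> nat).
Implicit Types T : sep_graph V.

Definition heavy T (q : nat) : pred T := fun s => q <= weight r s.

Definition heavy_edge T (q : nat) : pred (T * T) :=
  fun p => [&& edge p.1 p.2, heavy q p.1 & heavy q p.2].

Definition heavy_count (q : nat) T : nat := #|@heavy T q| + #|@heavy_edge T q|.

End Heavy.

Section Doubling.
Context {V : Type} (r : set V -> nat).
Variables (T : sep_graph V) (t t' : T) (x : sep V).

(* The leaf edges of the two shifted trees carry inverse separations, and are
   identified. *)
Definition doubling : sep_graph V :=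
  glue (t' : root_shift t' (sep_inv x)) (t : root_shift t x) x.

Definition doubling_fold (p : doubling) : T :=
  match p with inl s => s | inr s => s end.

Lemma sigma_doubling_inl (s : T) :
  sigma (inl s : doubling) = sigma (inr s : leaf_shift t' (sep_inv x)).
Proof. exact: sigma_glue_inl. Qed.

Lemma sigma_doubling_inr (s : T) :
  sigma (inr s : doubling) = sigma (inr s : leaf_shift t x).
Proof. exact: sigma_glue_inr. Qed.

Lemma weight_doubling_inl (s : T) :
  weight r (inl s : doubling) = weight r (inr s : leaf_shift t' (sep_inv x)).
Proof. by rewrite /weight /defect sigma_doubling_inl. Qed.

Lemma weight_doubling_inr (s : T) :
  weight r (inr s : doubling) = weight r (inr s : leaf_shift t x).
Proof. by rewrite /weight /defect sigma_doubling_inr. Qed.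

Variable q : nat.
Hypothesis weight_fold : forall p : doubling,
  weight r p <= weight r (doubling_fold p).
Hypothesis heavy_once : forall s : T,
  ~ (heavy r q (inl s : doubling) /\ heavy r q (inr s : doubling)).
Hypothesis bridge_light : ~ heavy r q (inl t' : doubling).

Let fold_inj : {in @heavy V r doubling q &, injective doubling_fold}.
Proof.
by move=> [u|u] [v|v]; rewrite -!topredE /= => hu hv /= E; rewrite E // in hu *;
  case: (@heavy_once v).
Qed.

Let fold_heavy (p : doubling) : heavy r q p -> heavy r q (doubling_fold p).
Proof. by move=> hp; apply: leq_trans hp (weight_fold p). Qed.

Let fold_pair (p : doubling * doubling) : T * T :=
  (doubling_fold p.1, doubling_fold p.2).

Let fold_pair_inj : {in @heavy_edge V r doubling q &, injective fold_pair}.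
Proof.
move=> [u v] [u' v'] /and3P[_ /= hu hv] /and3P[_ /= hu' hv'] [].
by move=> /(fold_inj hu hu') -> /(fold_inj hv hv') ->.
Qed.

Let fold_edge (u v : doubling) :
  edge u v -> heavy r q u -> heavy r q v ->
  edge (doubling_fold u) (doubling_fold v).
Proof.
by case: u v => [u|u] [v|v] //= /andP[/eqP E _] hu hv;
  case: bridge_light; rewrite -E.
Qed.

Let fold_heavy_edge (p : doubling * doubling) :
  heavy_edge r q p -> heavy_edge r q (fold_pair p).
Proof.
case: p => u v /and3P[/= uv hu hv]; apply/and3P.
by split; [apply: fold_edge | apply: fold_heavy | apply: fold_heavy].
Qed.

Lemma heavy_count_doubling : heavy_count r q doubling <= heavy_count r q T.
Proof.
apply: leq_add; first exact: leq_card_in_inj fold_inj fold_heavy.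
exact: leq_card_in_inj fold_pair_inj fold_heavy_edge.
Qed.

Lemma heavy_count_doubling_vert (s : T) : heavy r q s ->
  ~ heavy r q (inl s : doubling) -> ~ heavy r q (inr s : doubling) ->
  heavy_count r q doubling < heavy_count r q T.
Proof.
move=> hs light_l light_r; rewrite /heavy_count -addSn.
apply: leq_add; last first.
  exact: leq_card_in_inj fold_pair_inj fold_heavy_edge.
by apply: (ltn_card_in_inj fold_inj fold_heavy hs) => -[u|u] hu;
  apply/eqP => /= E; [apply: light_l | apply: light_r]; rewrite -E.
Qed.

Lemma heavy_count_doubling_edge (u v : T) :
  edge u v -> heavy r q u -> heavy r q v ->
  ~ heavy r q (inl v : doubling) -> ~ heavy r q (inr u : doubling) ->
  heavy_count r q doubling < heavy_count r q T.
Proof.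
move=> uv hu hv light_v light_u; rewrite /heavy_count -addnS; apply: leq_add.
  exact: leq_card_in_inj fold_inj fold_heavy.
apply: (ltn_card_in_inj (y := (u, v)) fold_pair_inj fold_heavy_edge).
  exact/and3P.
move=> -[a b] /and3P[/= ab ha hb]; apply/eqP => -[Ea Eb].
case: a b ab ha hb Ea Eb => [a|a] [b|b] /= ab ha hb Ea Eb.
- by apply: light_v; rewrite -Eb.
- by case/andP: ab => /eqP E _; apply: bridge_light; rewrite -E.
- by apply: light_v; rewrite -Eb.
- by apply: light_u; rewrite -Ea.
Qed.

End Doubling.

(** * Critical separations *)

Section CriticalTree.
Context {V : Type} (r : set V -> nat).
Variables (S : set (sep V)) (T : sep_graph V).
Hypotheses (r_mono : nondecreasing_setfun r) (r_sub : submodular r).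
Hypothesis S_univ : is_universe S.
Hypotheses (T_tree : is_sep_tree S T) (T_tame : tame T).

Implicit Types (s t u v i : T) (a x y : sep V).

Let T_is_tree : is_tree (@edge V T) := sep_tree_is_tree T_tree.
Let edgeC : symmetric (@edge V T) := edge_sym T_tree.
Let is_sepS x : S x -> is_sep x. Proof. exact: universe_sep. Qed.
Let rankE := rank_corank r_mono.

Lemma lab_cover s u v : edge u s -> edge v s -> u != v ->
  (lab u s).2 `|` (lab v s).2 = setT.
Proof.
move=> us vs /eqP uv; have [uv1 _] := lab_star T_tame us vs uv.
apply/seteqP; split=> // z _.
have /seteqP[_ /(_ z I)] := is_sepS (lab_in T_tree us).
by case=> [/uv1|]; [right | left].
Qed.

Lemma order_le_weight u s : edge u s -> sep_order r (lab u s) <= weight r s.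
Proof.
move=> us; rewrite /weight defectE (bigD1 u) //=.
have : \sum_(v : T | edge v s && (v != u)) corank r (lab v s).2 +
    r (lab u s).1 <= r setT.
  apply: sum_corank_le => // [i j /andP[i_s _] /andP[js _]|i /andP[i_s iu]].
    exact: lab_cover.
  by have [] := lab_star T_tame us i_s (nesym (elimN eqP iu)).
have := sep_orderE r_sub (is_sepS (lab_in T_tree us)).
have := rankE (lab u s).2; lia.
Qed.

Lemma fits_lab2 t a u : fits t a -> edge u t -> a.1 `<=` (lab u t).2.
Proof.
move=> ta ut; have tu : edge t u by rewrite edgeC.
by have [] := ta _ tu; rewrite (lab_inv T_tree ut).
Qed.

Lemma rank_le_weight t a : fits t a -> r a.1 <= weight r t.
Proof.
move=> ta; rewrite /weight defectE.
have : \sum_(u : T | edge u t) corank r (lab u t).2 + r a.1 <= r setT.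
  apply: sum_corank_le => // [i j|i it]; first exact: lab_cover.
  exact: fits_lab2 ta it.
lia.
Qed.

Lemma defect_shift_root t a x : S x -> sep_le a x -> fits t a ->
  defect r t + r a.1 <= defect r (inr t : leaf_shift t x) + sep_order r x.
Proof.
move=> Sx [ax _] ta; rewrite defect_add_leaf eqxx mul1n !defectE /=.
under [X in _ <= X + _ + _]eq_bigr => u _
  do rewrite (asboolF (away_root T_is_tree (u := u))) /=.
have : \sum_(u : T | edge u t) corank r (lab u t).2 + r a.1 <=
    \sum_(u : T | edge u t) corank r ((lab u t).2 `|` x.1) + r x.1.
  apply: sum_corank_setU => // [i j|i it]; first exact: lab_cover.
  exact: fits_lab2 ta it.
have := sep_orderE r_sub (is_sepS Sx); have := rankE x.2.
lia.
Qed.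

Lemma defect_shift_away t x i s : away (@edge V T) t i s ->
  defect r (inr s : leaf_shift t x) =
  corank r ((lab i s).2 `&` x.2) +
  \sum_(u : T | edge u s && (u != i)) corank r ((lab u s).2 `|` x.1).
Proof.
move=> ti; rewrite defect_add_leaf; have [E|_] := eqVneq s t.
  by rewrite E in ti; case: (away_root T_is_tree ti).
rewrite mul0n addn0 defectE (bigD1 (i : T)) /=; last exact: away_edge ti.
rewrite asboolT //=; congr (_ + _); apply: eq_bigr => u /andP[_ /eqP ui].
by rewrite asboolF // => tu; apply: ui (away_parent_uniq T_is_tree tu ti).
Qed.

Lemma defect_shift_corner t x i s : S x -> away (@edge V T) t i s ->
  defect r s + sep_order r (sep_meet (lab i s) x) <=
  defect r (inr s : leaf_shift t x) + sep_order r x.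
Proof.
move=> Sx ti; have i_s := away_edge ti; have Sis := lab_in T_tree i_s.
rewrite (defect_shift_away _ ti) defectE (bigD1 (i : T)) //=.
have : \sum_(u : T | edge u s && (u != i)) corank r (lab u s).2 +
         r ((lab i s).1 `&` x.1) <=
    \sum_(u : T | edge u s && (u != i)) corank r ((lab u s).2 `|` x.1) + r x.1.
  apply: sum_corank_setU => // [j k /andP[js _] /andP[ks _]|j /andP[js ji]].
    exact: lab_cover.
  have [ij _] := lab_star T_tame i_s js (nesym (elimN eqP ji)).
  by move=> z [/ij].
have := r_sub (lab i s).2 x.2; have := sep_orderE r_sub (is_sepS Sx).
have := sep_orderE r_sub (is_sepS (universe_meet S_univ Sis Sx)).
have := rankE (lab i s).2; have := rankE ((lab i s).2 `&` x.2).
rewrite /=; lia.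
Qed.

(* The shift gives the edge at s facing t the second side Y, and the edge facing
   t' a second side inside X; as r(X) + r(Y) = |x| + r(V), these two edges
   already contribute r(V) - |x| to the defect.  If they coincide, the second
   side lies in the separator of x. *)
Lemma defect_shift_far t t' x i s : S x -> away (@edge V T) t i s ->
  sep_le x (lab i s) ->
  r setT <= defect r (inr s : leaf_shift t' (sep_inv x)) + sep_order r x.
Proof.
move=> Sx ti [x1 x2]; have i_s := away_edge ti.
have xE := sep_orderE r_sub (is_sepS Sx).
have iE : (lab i s).2 `|` x.2 = x.2 by apply: setUidr.
have := rankE x.1; have := rankE x.2.
have [E|[j t'j]] := away_exists T_is_tree t' s.
  rewrite defect_add_leaf -E eqxx mul1n defectE (bigD1 (i : T)) //=.
  rewrite asboolF /=; last exact: away_root.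
  by rewrite iE; lia.
rewrite (defect_shift_away _ t'j) /=.
have := rankE ((lab j s).2 `&` x.1).
have [ij|ij] := eqVneq j i.
  have : r ((lab j s).2 `&` x.1) <= sep_order r x.
    by apply: rank_separator => //; [exact: is_sepS | rewrite ij => v [/x2]].
  lia.
rewrite (bigD1 (i : T)) ?i_s 1?eq_sym //= iE.
have : r ((lab j s).2 `&` x.1) <= r x.1 by apply: r_mono => v [].
lia.
Qed.

(* (t, a) and (t', a') violate leanness, and x is a separation of least order
   between them which crosses as few edges of T as possible. *)
Record critical t a t' a' x : Prop := Critical {
  critical_fits : fits t a;
  critical_fits' : fits t' a';
  critical_min : min_between r S a (sep_inv a') x;
  critical_rank : sep_order r x < r a.1;
  critical_rank' : sep_order r x < r a'.1;
  critical_path : forall u v, on_path_between (@edge V T) t t' u v ->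
    sep_order r x < sep_order r (lab u v);
  critical_crossings : forall y, min_between r S a (sep_inv a') y ->
    crossings T x <= crossings T y
}.

Lemma critical_sym t a t' a' x :
  critical t a t' a' x -> critical t' a' t a (sep_inv x).
Proof.
move=> [ta ta' minx xa xa' path cross]; split; rewrite ?sep_order_inv //.
- by have := min_between_inv S_univ minx; rewrite sep_invK.
- move=> u v /(on_path_between_sym edgeC) uv.
  have vu := away_edge (proj1 ((on_path_betweenP T_is_tree _ _ _ _).1 uv)).
  by rewrite (lab_inv T_tree vu) sep_order_inv path.
- move=> y /(min_between_inv S_univ); rewrite sep_invK crossings_inv => /cross.
  by rewrite crossings_inv.
Qed.

Section CriticalShift.
Variables (t t' : T) (a a' x : sep V).
Hypothesis x_crit : critical t a t' a' x.

Lemma critical_in : S x.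
Proof. by have [[]] := critical_min x_crit. Qed.

Lemma critical_le : sep_le a x.
Proof. by have [[]] := critical_min x_crit. Qed.

Lemma critical_corner u v : away (@edge V T) t u v ->
  between S a (sep_inv a') (sep_meet (lab u v) x).
Proof.
have [[Sx ax xa'] _] := critical_min x_crit => tu; split.
- exact: universe_meet S_univ (lab_in T_tree (away_edge tu)) Sx.
- exact: sep_le_meet (fits_away T_tree T_tame (critical_fits x_crit) tu) ax.
- exact: sep_le_trans (sep_meet_ler _ _) xa'.
Qed.

Lemma critical_nested u v : away (@edge V T) t u v ->
  sep_order r (sep_meet (lab u v) x) <= sep_order r x -> nested x (lab u v).
Proof.
move=> tu corner_le; apply: contrapT => x_uv.
have [_ minx] := critical_min x_crit.
have := crossings_meet_lt T_tree T_tame (away_edge tu) x_uv.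
rewrite ltnNge (critical_crossings x_crit) //; split.
  exact: critical_corner.
by move=> y /minx; apply: leq_trans.
Qed.

Lemma critical_weight_root : sep_order r x < weight r t.
Proof.
apply: leq_trans (critical_rank x_crit) _.
exact: rank_le_weight (critical_fits x_crit).
Qed.

Lemma critical_weight_shift s : weight r (inr s : leaf_shift t x) <= weight r s.
Proof.
apply: leq_sub2l; have [_ minx] := critical_min x_crit.
have [->|[i ti]] := away_exists T_is_tree t s.
  have := critical_rank x_crit.
  have := defect_shift_root critical_in critical_le (critical_fits x_crit).
  lia.
have := defect_shift_corner critical_in ti.
by have := minx _ (critical_corner ti); lia.
Qed.

Lemma critical_weight_shift_root :
  weight r (inr t : leaf_shift t x) < weight r t.
Proof.
have := critical_weight_root; have := critical_rank x_crit.
have := defect_shift_root critical_in critical_le (critical_fits x_crit).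
by rewrite /weight; lia.
Qed.

Lemma critical_weight_other_copy s : sep_order r x < weight r s ->
  weight r s <= weight r (inr s : leaf_shift t x) ->
  weight r (inr s : leaf_shift t' (sep_inv x)) <= sep_order r x.
Proof.
move=> xs keep; have Sx := critical_in; have sx := universe_sep S_univ Sx.
have [E|[i ti]] := away_exists T_is_tree t s.
  by rewrite E in keep; have := critical_weight_shift_root; lia.
have i_s := away_edge ti.
have corner : sep_order r (sep_meet (lab i s) x) <= sep_order r x.
  have := defect_shift_corner Sx ti.
  by move: xs keep; rewrite /weight; lia.
have [xi|[_ xi]|ix|[ix _]] := critical_nested ti corner.
- by have := defect_shift_far t' Sx ti xi; rewrite /weight; lia.
- have [ai _] := fits_away T_tree T_tame (critical_fits x_crit) ti.
  have := critical_rank x_crit; rewrite ltnNge rank_separator //.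
    by case: critical_le.
  by move=> z /ai/xi.
- rewrite sep_meet_l // in corner.
  have [t'i|t's] := away_total T_is_tree t' i_s; last first.
    have is_path := (on_path_betweenP T_is_tree _ _ _ _).2 (conj ti t's).
    by have := critical_path x_crit is_path; rewrite ltnNge corner.
  have [ai _] := fits_away T_tree T_tame (critical_fits' x_crit) t'i.
  have := critical_rank' x_crit; rewrite ltnNge rank_separator //.
    by case: ix => ix _ z /ai/ix.
  by have [[_ _ []]] := critical_min x_crit.
- have : r ((lab i s).2 `&` x.2) <= sep_order r x.
    by apply: rank_separator => // z [] // /ix.
  have := rankE ((lab i s).2 `&` x.2).
  by move: xs keep; rewrite /weight (defect_shift_away _ ti); lia.
Qed.

End CriticalShift.

Section CriticalDouble.
Variables (t t' : T) (a a' x : sep V).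
Hypothesis x_crit : critical t a t' a' x.

Local Notation D := (doubling t t' x).
Let x_crit' := critical_sym x_crit.

Definition collapsed (s : T) : bool :=
  [&& sep_order r x < weight r s, weight r (inl s : D) < weight r s
    & weight r (inr s : D) < weight r s].

Lemma critical_weight_fold (p : D) : weight r p <= weight r (doubling_fold p).
Proof.
case: p => s; rewrite ?weight_doubling_inl ?weight_doubling_inr.
  exact: critical_weight_shift x_crit' s.
exact: critical_weight_shift x_crit s.
Qed.

Lemma critical_uncollapsed s : sep_order r x < weight r s -> ~~ collapsed s ->
  weight r (inl s : D) = weight r s /\ weight r (inr s : D) <= sep_order r x \/
  weight r (inr s : D) = weight r s /\ weight r (inl s : D) <= sep_order r x.
Proof.
move=> xs; rewrite /collapsed xs /= negb_and -!leqNgt.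
move=> /orP[keep|keep]; [left | right]; split.
- by apply/eqP; rewrite eqn_leq keep critical_weight_fold.
- have := critical_weight_other_copy x_crit' (s := s).
  rewrite sep_order_inv sep_invK weight_doubling_inr; apply=> //.
  by rewrite -(weight_doubling_inl r t).
- by apply/eqP; rewrite eqn_leq keep critical_weight_fold.
- rewrite weight_doubling_inl; apply: (critical_weight_other_copy x_crit xs).
  by rewrite -(weight_doubling_inr r t t').
Qed.

Lemma critical_weight_root' : sep_order r x < weight r t'.
Proof.
rewrite -(sep_order_inv r x).
exact: critical_weight_root x_crit'.
Qed.

Lemma critical_weight_inl_lt : weight r (inl t' : D) < weight r t'.
Proof.
rewrite weight_doubling_inl.
exact: critical_weight_shift_root x_crit'.
Qed.

Lemma critical_weight_inr_lt : weight r (inr t : D) < weight r t.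
Proof.
rewrite weight_doubling_inr.
exact: critical_weight_shift_root x_crit.
Qed.

Section Threshold.
Variable q : nat.
Hypothesis xq : sep_order r x < q.
Hypothesis collapsed_le : forall s, collapsed s -> weight r s <= q.

Lemma critical_heavy_once (s : T) :
  ~ (heavy r q (inl s : D) /\ heavy r q (inr s : D)).
Proof.
rewrite /heavy => -[hl hr].
have xs : sep_order r x < weight r s.
  exact: leq_trans xq (leq_trans hl (critical_weight_fold _)).
have [cs|/(critical_uncollapsed xs)] := boolP (collapsed s); last by lia.
by have := collapsed_le cs; case/and3P: cs; lia.
Qed.

Lemma critical_bridge_light : ~ heavy r q (inl t' : D).
Proof.
rewrite /heavy => hl.
have := critical_weight_inl_lt; have xt' := critical_weight_root'.
have [ct'|/(critical_uncollapsed xt')] := boolP (collapsed t'); last by lia.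
by have := collapsed_le ct'; lia.
Qed.

Lemma critical_heavy_count : heavy_count r q D <= heavy_count r q T.
Proof.
exact: heavy_count_doubling critical_weight_fold critical_heavy_once
  critical_bridge_light.
Qed.

Lemma critical_heavy_count_collapsed s : collapsed s -> weight r s = q ->
  heavy_count r q D < heavy_count r q T.
Proof.
move=> /and3P[_ ls rs] sq.
apply: (heavy_count_doubling_vert critical_weight_fold critical_heavy_once
  critical_bridge_light (s := s)); rewrite /heavy; lia.
Qed.

End Threshold.

Lemma critical_path_heavy u v : on_path_between (@edge V T) t t' u v ->
  [/\ edge u v, sep_order r x < weight r u & sep_order r x < weight r v].
Proof.
move=> uv_path; have x_uv := critical_path x_crit uv_path.
have [/away_edge uv _] := (on_path_betweenP T_is_tree _ _ _ _).1 uv_path.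
split=> //; apply: leq_trans x_uv _; last exact: order_le_weight.
by rewrite -sep_order_inv -(lab_inv T_tree uv) order_le_weight // edgeC.
Qed.

Lemma critical_switch : (forall s, ~~ collapsed s) ->
  exists u v, [/\ on_path_between (@edge V T) t t' u v,
    sep_order r x < weight r (inl u : D) &
    weight r (inl v : D) <= sep_order r x].
Proof.
move=> uncollapsed.
have [_ _ _ conn _] := T_is_tree; have /connectP[p0 pp0 lp0] := conn t t'.
case/shortenP: pp0 lp0 => p pp up _ lp.
pose left_heavy s := sep_order r x < weight r (inl s : D).
have heavy_t : left_heavy t.
  have xt := critical_weight_root x_crit; have := critical_weight_inr_lt.
  by have := critical_uncollapsed xt (uncollapsed t); rewrite /left_heavy; lia.
have light_t' : ~~ left_heavy (last t p).
  have xt' := critical_weight_root'; have := critical_weight_inl_lt.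
  have := critical_uncollapsed xt' (uncollapsed t').
  by rewrite -lp /left_heavy; lia.
have [u [v [uv heavy_u light_v]]] := path_exit heavy_t light_t'.
by exists u, v; split=> //; [exists p | rewrite leqNgt].
Qed.

Lemma critical_heavy_count_uncollapsed : (forall s, ~~ collapsed s) ->
  heavy_count r (sep_order r x).+1 D < heavy_count r (sep_order r x).+1 T.
Proof.
move=> uncollapsed.
have [u [v [/critical_path_heavy[uv xu xv] heavy_u light_v]]] :=
  critical_switch uncollapsed.
have vacuous s : collapsed s -> weight r s <= (sep_order r x).+1.
  by rewrite (negPf (uncollapsed s)).
apply: (heavy_count_doubling_edge critical_weight_fold
  (critical_heavy_once (ltnSn _) vacuous)
  (critical_bridge_light (ltnSn _) vacuous) uv); rewrite /heavy //; first lia.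
by have := critical_uncollapsed xu (uncollapsed u); lia.
Qed.

Lemma critical_heavy_count_lex : exists q, [/\ q <= r setT,
  heavy_count r q D < heavy_count r q T &
  forall q', q < q' -> heavy_count r q' D <= heavy_count r q' T].
Proof.
have [[s0 cs0]|none] := pselect (exists s, collapsed s); last first.
  have uncollapsed s : ~~ collapsed s.
    by apply/negP => cs; apply: none; exists s.
  exists (sep_order r x).+1; split.
  - exact: leq_trans (critical_weight_root x_crit) (leq_subr _ _).
  - exact: critical_heavy_count_uncollapsed.
  - move=> q' /ltnW xq'; apply: critical_heavy_count xq' _ => s.
    by rewrite (negPf (uncollapsed s)).
case: (arg_maxnP (fun s => weight r s) cs0) => s cs max_s.
have xs : sep_order r x < weight r s by case/and3P: cs.
exists (weight r s); split; first exact: leq_subr.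
- exact: critical_heavy_count_collapsed xs max_s _ cs _.
- move=> q' sq'; apply: critical_heavy_count (ltn_trans xs sq') _ => s'.
  by move/max_s=> ss'; apply: leq_trans ss' (ltnW sq').
Qed.

End CriticalDouble.

End CriticalTree.

(** * Doubling a tree that is not lean *)

Section NotLean.
Context {V : Type} (S : set (sep V)) (r : set V -> nat) (k : nat).
Variable F : set {mset sep V}%mset.
Hypothesis S_univ : is_universe S.
Hypothesis F_star : forall s, F s ->
  is_star s /\ (forall a, a \in s -> sep_lt_order S r k a).
Hypothesis F_fixed : fixed_under_shifting S r (sep_lt_order S r k) F.

Local Notation R := (sep_lt_order S r k).

Implicit Types a x : sep V.

Lemma sep_lt_order_inv a : R a -> R (sep_inv a).
Proof.
by move=> [Sa ak]; split; [apply: universe_inv | rewrite sep_order_inv].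
Qed.

Lemma tree_over_tame (G : sep_graph V) : tree_over F G -> tame G.
Proof. by move=> G_over s; have [] := F_star (G_over s). Qed.

Variable T : sep_graph V.
Hypotheses (T_tree : is_sep_tree R T) (T_over : tree_over F T).

Let T_is_tree : is_tree (@edge V T) := sep_tree_is_tree T_tree.
Let T_tame : tame T := tree_over_tame T_over.

Lemma addable_lt_order a (t : T) : addable F a t -> R a.
Proof. by case/F_star => _; apply; rewrite in_mset1D eqxx. Qed.

Lemma add_leaf_over (t : T) a : addable F a t ->
  forall s : T, F (sigma (inr s : add_leaf t a)).
Proof.
move=> ta s; have [->|st] := pselect (s = t); first by rewrite sigma_leaf_root.
by rewrite sigma_leaf_other.
Qed.

Lemma add_leaf_tame (t : T) a : addable F a t -> tame (add_leaf t a).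
Proof.
move=> ta [[]|s]; last by have [] := F_star (add_leaf_over ta s).
by apply/is_star_sigma => -[[]|u] [[]|v] //= /eqP-> /eqP->.
Qed.

Lemma add_leaf_tree (t : T) a : R a -> is_sep_tree R (add_leaf t a).
Proof.
move=> Ra; split; first exact: leaf_rel_tree.
case=> [[]|u] [[]|v] //= uv.
- by rewrite sep_invK; split=> //; apply: sep_lt_order_inv.
- by split; [apply: (lab_in T_tree) | apply: (lab_inv T_tree)].
Qed.

Lemma addable_fits a (t : T) : addable F a t -> fits t a.
Proof.
move=> ta u tu; have ut : edge u t by rewrite (edge_sym T_tree).
rewrite (lab_inv T_tree ut).
by apply: (lab_star (add_leaf_tame ta) (u := inl tt) (v := inr u) (s := inr t));
  rewrite /= ?eqxx.
Qed.

Lemma leaf_shift_over (t : T) a x s : addable F a t -> R x ->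
  min_between r S a x x -> F (sigma (inr s : leaf_shift t x)).
Proof.
move=> ta Rx minx; have [[_ ax _] _] := minx.
pose p : shift (inl tt : add_leaf t a) (inr t) x :=
  exist _ (inr s) (leaf_branch_vert t T_is_tree (inr s)).
rewrite -(sigma_shift_leaf (p := p) T_is_tree ax erefl).
apply: F_fixed => //=.
- exact: add_leaf_tree (addable_lt_order ta).
- exact: add_leaf_tame.
- exact: min_between_linked minx.
- exact: add_leaf_over.
Qed.

Section DoublingOver.
Variables (t t' : T) (a a' x : sep V).
Hypotheses (ta : addable F a t) (ta' : addable F a' t').
Hypothesis minx : min_between r S a (sep_inv a') x.

Let Rx : R x.
Proof.
have [[Sx _ _] min] := minx; have [Sa ak] := addable_lt_order ta.
split=> //; apply: leq_ltn_trans (min _ _) ak; split=> //.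
  exact: sep_le_refl.
by have [[_ ax xa'] _] := minx; apply: sep_le_trans ax xa'.
Qed.

Lemma doubling_over : tree_over F (doubling t t' x).
Proof.
have minx' := min_between_inv S_univ minx; rewrite sep_invK in minx'.
case=> s; rewrite ?sigma_doubling_inl ?sigma_doubling_inr.
  exact: leaf_shift_over ta' (sep_lt_order_inv Rx) (min_between_target minx').
exact: leaf_shift_over ta Rx (min_between_target minx).
Qed.

Lemma doubling_tree : is_sep_tree R (doubling t t' x).
Proof.
split=> [|p q pq]; first exact: glue_tree.
split; first by have [_] := F_star (doubling_over q); apply; apply: mem_sigma.
case: p q pq => [u|u] [v|v] pq; rewrite /= ?sep_invK //.
- exact: (@root_shift_inv _ _ _ T_tree t' (sep_inv x)).
- exact: (@root_shift_inv _ _ _ T_tree t x).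
Qed.

End DoublingOver.

Lemma lt_order_sep_tree : is_sep_tree S T.
Proof.
split=> // u v uv; split; last exact: (lab_inv T_tree).
by case: (lab_in T_tree uv).
Qed.

Lemma not_lean_critical : ~ lean S r F T -> exists t t' a a' x,
  [/\ addable F a t, addable F a' t' & @critical _ r S T t a t' a' x].
Proof.
have ST := lt_order_sep_tree.
move/existsNP=> [t] /existsNP[t'] /existsNP[a] /existsNP[a'].
move=> /not_implyP[ta] /not_implyP[ta'] /not_implyP[aa'].
move=> /not_orP[/negP rank path].
have [Sa _] := addable_lt_order ta.
have [x0 minx0] := min_between_exists r Sa aa'.
have [x [minx few]] := ex_argmin (crossings T) (ex_intro _ x0 minx0).
rewrite (lambda_eq minx) -ltnNge leq_min in rank path.
case/andP: rank => xa xa'.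
exists t, t', a, a', x; split=> //; split=> //; try exact: addable_fits.
have ge_x u v : on_path_between (@edge V T) t t' u v ->
    sep_order r x <= sep_order r (lab u v).
  move=> /(on_path_betweenP T_is_tree)[tu t'v]; have uv := away_edge tu.
  apply: (proj2 minx); split; first exact: (lab_in ST uv).
    exact: (fits_away ST T_tame (addable_fits ta) tu).
  apply: sep_le_invC; rewrite -(lab_inv T_tree uv).
  exact: (fits_away ST T_tame (addable_fits ta') t'v).
move=> u v uv; rewrite ltn_neqAle ge_x // andbT; apply/eqP => E.
by apply: path; split=> [|_ [u' [v' [uv' ->]]]]; [exists u, v | apply: ge_x].
Qed.

Hypotheses (r_mono : nondecreasing_setfun r) (r_sub : submodular r).

Lemma not_lean_heavy_count : ~ lean S r F T -> exists D q,
  [/\ is_sep_tree R D /\ tree_over F D, q <= r setT,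
    heavy_count r q D < heavy_count r q T &
    forall q', q < q' -> heavy_count r q' D <= heavy_count r q' T].
Proof.
move=> /not_lean_critical[t [t' [a [a' [x [ta ta' x_crit]]]]]].
have [q [qN lt_q le_gt_q]] :=
  critical_heavy_count_lex r_mono r_sub S_univ lt_order_sep_tree T_tame x_crit.
have minx := critical_min x_crit.
exists (doubling t t' x), q; split=> //; split.
- exact: doubling_tree ta ta' minx.
- exact: doubling_over ta ta' minx.
Qed.

End NotLean.

Theorem theorem4p1 (V : Type) (S : set (sep V)) (r : set V -> nat) (k : nat)
    (F : set {mset sep V}%mset) :
  is_universe S ->
  nondecreasing_setfun r ->
  submodular r ->
  (forall s, F s ->
     is_star s /\ (forall a, a \in s -> sep_lt_order S r k a)) ->
  fixed_under_shifting S r (sep_lt_order S r k) F ->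
  (exists T : sep_graph V,
     is_sep_tree (sep_lt_order S r k) T /\ tree_over F T) ->
  exists T : sep_graph V,
    [/\ is_sep_tree (sep_lt_order S r k) T, tree_over F T & lean S r F T].
Proof.
move=> S_univ r_mono r_sub F_star F_fixed exT.
have [T [[T_tree T_over] minT]] :=
  ex_lexmin (fun i => heavy_count r (r setT - i)) (r setT).+1 exT.
exists T; split=> //; apply: contrapT => nlean.
have [D [q [D_tree qN lt_q le_gt_q]]] :=
  not_lean_heavy_count S_univ F_star F_fixed T_tree T_over r_mono r_sub nlean.
have := minT D D_tree (r setT - q); rewrite subKn // ltnS leq_subr => minD.
have : heavy_count r q T <= heavy_count r q D.
  by apply: minD => // j jq; apply: le_gt_q; lia.
by rewrite leqNgt lt_q.
Qed.
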